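(* Let $n$ and $k$ be positive integers such that $n\ge4k$. Then, for every tree $T$ with $k$ edges, ${\rm ot}(n,T)\le(k-1)n$.
   Context: A $2$-coloring $E(K_n)=E(R)\cup E(B)$ is a partition of the edges of $K_n$ into red edges (forming $R$) and blue edges (forming $B$); $e(\cdot)$ denotes number of edges. An $(r,b)$-colored copy of a graph $G$ (with $r+b=e(G)$) is a (not necessarily induced) subgraph of $K_n$ isomorphic to $G$ with exactly $r$ red and $b$ blue edges. ${\rm ot}(n,G)$ is the minimum non-negative integer $s$ such that every $2$-coloring $E(K_n)=E(R)\cup E(B)$ with $\min\{e(R),e(B)\}>s$ contains an $(r,b)$-colored copy of $G$ for every pair of integers $r,b\ge0$ with $r+b=e(G)$. *)

(* Defs.v *)
From mathcomp Require Import all_boot.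

Set Implicit Arguments.
Unset Strict Implicit.
Unset Printing Implicit Defensive.

Record sgraph := SGraph {
  vertex :> finType;
  adj : rel vertex;
  adj_sym : symmetric adj;
  adj_irrefl : irreflexive adj
}.

Definition edges (G : sgraph) : {set {set G}} :=
  [set [set p.1; p.2] | p in [pred p : G * G | adj p.1 p.2]].

Definition nedges (G : sgraph) : nat := #|edges G|.

Definition connected (G : sgraph) : Prop :=
  forall x y : G, connect (@adj G) x y.

(* [ucycle] also accepts closed sequences of length 0 and 2, which are not
   graph cycles. *)
Definition acyclic (G : sgraph) : Prop :=
  forall c : seq G, ucycle (@adj G) c -> size c < 3.

Definition is_tree (G : sgraph) : Prop :=
  [/\ 0 < #|G|, connected G & acyclic G].

Definition neq_rel (T : finType) : rel T := fun x y => x != y.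

Lemma neq_rel_sym (T : finType) : symmetric (@neq_rel T).
Proof. by move=> x y; rewrite /neq_rel eq_sym. Qed.

Lemma neq_rel_irrefl (T : finType) : irreflexive (@neq_rel T).
Proof. by move=> x; rewrite /neq_rel eqxx. Qed.

Definition K (n : nat) : sgraph :=
  SGraph (@neq_rel_sym 'I_n) (@neq_rel_irrefl 'I_n).

Lemma edges_KE (n : nat) : edges (K n) = [set e : {set 'I_n} | #|e| == 2].
Proof.
apply/setP=> e; rewrite [RHS]inE; apply/imsetP/cards2P.
  by case=> -[x y] xy ->; exists x, y.
by move=> [x [y [xy ->]]]; exists (x, y).
Qed.

(* A color class may be empty. *)
Definition two_coloring (n : nat) (R B : {set {set K n}}) : bool :=
  (R :|: B == edges (K n)) && [disjoint R & B].

(* The subgraph of H with vertex set W and edge set F is isomorphic to G.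
   It need not be induced: F may omit edges of H inside W. *)
Definition is_copy (G H : sgraph) (W : {set H}) (F : {set {set H}}) : bool :=
  (F \subset edges H) &&
  [exists f : {ffun G -> H},
     [&& injectiveb f, f @: [set: G] == W
       & [set f @: e | e : {set G} in edges G] == F]].

Definition colored_copy (n : nat) (G : sgraph) (R B : {set {set K n}})
    (r b : nat) : bool :=
  [exists W : {set K n}, exists F : {set {set K n}},
     [&& is_copy G W F, #|F :&: R| == r & #|F :&: B| == b]].

Definition omnitonal (n : nat) (G : sgraph) (R B : {set {set K n}}) : bool :=
  [forall r : 'I_(nedges G).+1, forall b : 'I_(nedges G).+1,
     (r + b == nedges G) ==> colored_copy G R B r b].

Lemma omnitonalP (n : nat) (G : sgraph) (R B : {set {set K n}}) :
  reflect (forall r b : nat, r + b = nedges G -> colored_copy G R B r b)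
          (omnitonal G R B).
Proof.
apply: (iffP forallP) => [rbP r b rbE | rbP r].
  have ltr : r < (nedges G).+1 by rewrite ltnS -rbE leq_addr.
  have ltb : b < (nedges G).+1 by rewrite ltnS -rbE leq_addl.
  have /forallP/(_ (Ordinal ltb))/implyP := rbP (Ordinal ltr).
  by apply; apply/eqP.
by apply/forallP=> b; apply/implyP=> /eqP; apply: rbP.
Qed.

Definition ot_bound (n : nat) (G : sgraph) (s : nat) : bool :=
  [forall R : {set {set K n}}, forall B : {set {set K n}},
     two_coloring R B ==> (s < minn #|R| #|B|) ==> omnitonal G R B].

Lemma ot_bound_exists (n : nat) (G : sgraph) : exists s, ot_bound n G s.
Proof.
exists #|edges (K n)|; apply/forallP=> R; apply/forallP=> B.
apply/implyP=> /andP[/eqP RB _]; apply/implyP.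
rewrite leq_min => /andP[ltR _].
have: #|R| <= #|edges (K n)| by rewrite -RB subset_leq_card // subsetUl.
by rewrite leqNgt ltR.
Qed.

Definition ot (n : nat) (G : sgraph) : nat := ex_minn (ot_bound_exists n G).

(* Main.v *)
Require Import Defs.
From mathcomp Require Import all_boot.
From mathcomp Require Import zify.

(* Every tree with at least two edges arises from a smaller tree T0 by joining a
   new vertex u to a vertex w of T0 and hanging at least one new leaf on u: take
   for u the parent of a deepest vertex. Induct on this construction. A graph
   with more than (k-1)|S| edges on S has a nonempty induced subgraph of minimum
   degree at least k, in which T embeds greedily; this settles r = 0 and b = 0.
   If r, b > 0, some vertex z has at least k red and at least k blue neighbours,
   for otherwise the vertices of red degree < k and those of blue degree < k
   cover S, and counting edges is contradictory. Deleting z costs each colour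
   fewer than n edges, so by induction T0 has a copy avoiding z with at most r-1
   red and at most b-1 blue edges. Place u at z: whatever the colour of the edge
   from w to z, the colours of the leaf edges at z can be chosen so as to reach
   exactly r red edges. *)

Set Implicit Arguments.
Unset Strict Implicit.
Unset Printing Implicit Defensive.

(** * Trees assembled star by star *)

(* [ls] may be empty only for the tree with a single edge. *)
Inductive star_built (T : eqType) : seq T -> seq (T * T) -> Prop :=
| star_built_point x : star_built [:: x] [::]
| star_built_star vs es w u ls of star_built vs es & w \in vs
    & uniq (u :: ls ++ vs) & (ls != [::]) || (es == [::]) :
    star_built (u :: ls ++ vs) ((w, u) :: [seq (u, l) | l <- ls] ++ es).

Section StarBuilt.

Variable T : eqType.
Implicit Types (vs : seq T) (es : seq (T * T)).

Lemma star_built_uniq vs es : star_built vs es -> uniq vs.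
Proof. by case. Qed.

Lemma star_built_size vs es : star_built vs es -> size vs = (size es).+1.
Proof.
elim=> [//|{}vs {}es w u ls _ IH _ _ _].
by rewrite /= !size_cat size_map IH; lia.
Qed.

Lemma star_built_mem vs es e :
  star_built vs es -> e \in es -> (e.1 \in vs) && (e.2 \in vs).
Proof.
elim=> [//|{}vs {}es w u ls _ IH wvs _ _].
rewrite [in X in X -> _]in_cons [in X in X -> _]mem_cat.
case/or3P=> [/eqP-> /=|/mapP[l lls ->] /=|/IH /andP[e1 e2]].
- by rewrite !inE !mem_cat wvs eqxx !orbT.
- by rewrite !inE !mem_cat lls eqxx orbT.
- by rewrite !inE !mem_cat e1 e2 !orbT.
Qed.

End StarBuilt.

(** Every new edge has an endpoint outside [vs], and two edges of the new star differ in their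
    endpoint other than [u]. Thus [size es] still counts edges when pairs are read as unordered. *)
Lemma star_built_uniq_edges (T : finType) (vs : seq T) (es : seq (T * T)) :
  star_built vs es -> uniq [seq [set e.1; e.2] | e <- es].
Proof.
elim=> [//|{}vs {}es w u ls tr IH wvs /= /andP[unin]].
rewrite mem_cat negb_or cat_uniq in unin *.
case/andP: unin => uls uvs /and3P[uniq_ls /hasPn dis _] _.
have old x e : x \notin vs -> e \in es -> x \notin [set e.1; e.2].
  move=> xvs ees; have /andP[e1 e2] := star_built_mem tr ees.
  by rewrite !inE negb_or; apply/andP; split; apply: contraNneq xvs => ->.
have wls : w \notin ls by exact: dis.
rewrite map_cat mem_cat cat_uniq IH andbT -!map_comp negb_or.
rewrite map_inj_in_uniq ?uniq_ls /=; last first.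
  move=> l l' lls l'ls /= E; have : l \in [set u; l'] by rewrite -E !inE eqxx orbT.
  by rewrite !inE => /orP[]/eqP // lu; rewrite -lu lls in uls.
apply/andP; split; last first.
  apply/hasPn=> _ /mapP[e ees ->]; apply/mapP=> -[l lls /= E].
  have /(old l e)/(_ ees) : l \notin vs by apply: contraL lls => /dis.
  by rewrite E !inE eqxx orbT.
apply/andP; split.
  apply/mapP=> -[l lls /= E].
  have : w \in [set u; l] by rewrite -E !inE eqxx.
  rewrite !inE => /orP[]/eqP wE; first by rewrite -wE wvs in uvs.
  by rewrite wE lls in wls.
apply/mapP=> -[e ees E].
by have := old u e uvs ees; rewrite -E !inE eqxx orbT.
Qed.

(** * Decomposition of rooted trees into stars *)

(** The tree is encoded by parent pointers. Since [d] drops by one at each step, every chain of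
    parents in [X] ends at [x0]; the value [par x0] is arbitrary. *)
Record rooted_on (T : finType) (adj : rel T) (X : {set T}) (x0 : T)
    (par : T -> T) (d : T -> nat) : Prop := RootedOn {
  root_in : x0 \in X;
  root_depth : d x0 = 0;
  par_in : forall x, x \in X -> x != x0 -> par x \in X;
  par_adj : forall x, x \in X -> x != x0 -> adj x (par x);
  par_depth : forall x, x \in X -> x != x0 -> d x = (d (par x)).+1 }.

(** The children [L] of the parent [u] of a deepest vertex are childless, so unless [u] is the root,
    deleting [u] and [L] leaves a smaller rooted set that contains [par u]. *)
Lemma rooted_star_built (T : finType) (adj : rel T) (X : {set T}) x0 par d :
  symmetric adj -> rooted_on adj X x0 par d ->
  exists vs es, [/\ star_built vs es, vs =i X & {in es, forall e, adj e.1 e.2}].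
Proof.
move=> adjC; have [m] := ubnP #|X|; elim: m X => // m IH X.
rewrite ltnS => ltXm [x0X d0 pX pa pd].
have [X1|[v0 v0X]] := set_0Vmem (X :\ x0).
  exists [:: x0], [::]; split=> // [|x]; first exact: star_built_point.
  have /setP/(_ x) := X1; rewrite !inE => /negbT.
  by case: eqVneq => [->|_] //= /negbTE->.
have [v /setD1P[vx0 vX] vmax] := arg_maxnP d v0X.
pose u := par v; pose L := [set x in X | (x != x0) && (par x == u)].
have vL : v \in L by rewrite inE vX vx0 /=.
have uX : u \in X by exact: pX.
have dL x : x \in L -> d x = (d u).+1.
  by rewrite inE => /and3P[xX xx0 /eqP px]; rewrite pd ?px.
have dle x : x \in X -> x != x0 -> d x <= (d u).+1.
  by move=> xX xx0; rewrite -(dL v vL); apply: vmax; apply/setD1P.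
have uL : u \notin L by apply/negP=> /dL; lia.
have nparL x : x \in X -> x != x0 -> par x \notin L.
  by move=> xX xx0; apply/negP=> /dL dp; have := dle x xX xx0; rewrite pd // dp; lia.
(* A root [u] has no parent to hang from. All depths are then at most 1, so [X] is a star with
   centre [u], built from the point [v]; further leaves may be absent, as the old edge list is
   empty. *)
have [ux0|ux0] := eqVneq u x0.
  exists (u :: enum (L :\ v) ++ [:: v]),
    ((v, u) :: [seq (u, l) | l <- enum (L :\ v)] ++ [::]); split.
  - apply: star_built_star; rewrite ?inE ?orbT //; first exact: star_built_point.
    rewrite /= cat_uniq enum_uniq /= !orbF andbT mem_cat mem_enum !inE.
    rewrite negb_or mem_enum !inE eqxx /= andbT.
    by rewrite ux0 eqxx /= !andbF /= eq_sym.
  - move=> x; rewrite in_cons mem_cat mem_enum !inE.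
    have [->|xu] /= := eqVneq x u; first by rewrite uX.
    have [->|xv] /= := eqVneq x v; first by rewrite vX ?orbT.
    rewrite orbF; apply/idP/idP => [/andP[]//|xX]; rewrite xX /= -ux0 xu /=.
    have xx0 : x != x0 by rewrite -ux0.
    apply/negPn/negP => pxu; have px0 : par x != x0 by rewrite -ux0.
    have := dle x xX xx0; rewrite pd // ux0 d0.
    by rewrite (pd (par x)) // pX.
  - move=> e; rewrite cats0 inE => /orP[/eqP->|/mapP[l]] /=; first exact: pa.
    rewrite mem_enum !inE => /and4P[_ lX lx0 /eqP lu] -> /=.
    by rewrite -lu adjC pa.
pose Y := X :\: (u |: L).
have sYX : Y \subset X by apply: subsetDl.
have YP x : (x \in Y) = [&& x \in X, x != u & x \notin L].
  by rewrite in_setD !in_setU1 negb_or; case: (x \in X); rewrite ?andbT ?andbF.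
have parY x : x \in X -> x != x0 -> x \notin L -> par x \in Y.
  move=> xX xx0 xL; rewrite YP pX // nparL // andbT /=.
  by apply: contra xL => pxu; rewrite inE xX xx0.
have [||vs [es [tr vsY eadj]]] := IH Y.
- apply: leq_trans ltXm; apply: proper_card; rewrite properE sYX /=.
  by apply/subsetPn; exists u; rewrite ?uX // YP eqxx andbF.
- split=> //; first by rewrite YP x0X eq_sym ux0 inE eqxx andbF.
  + by move=> x; rewrite YP => /and3P[xX _ xL] xx0; apply: parY.
  + by move=> x; rewrite YP => /and3P[xX _ xL] xx0; apply: pa.
  + by move=> x; rewrite YP => /and3P[xX _ xL] xx0; apply: pd.
exists (u :: enum L ++ vs), ((par u, u) :: [seq (u, l) | l <- enum L] ++ es).
split.
- apply: star_built_star => //; first by rewrite vsY parY.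
  + rewrite /= cat_uniq enum_uniq (star_built_uniq tr) andbT /= mem_cat mem_enum.
    rewrite (negbTE uL) vsY YP eqxx andbF /=.
    by apply/hasPn=> x; rewrite vsY YP mem_enum => /and3P[].
  + apply/orP; left; apply/eqP => L0.
    by have := vL; rewrite -mem_enum L0.
- move=> x; rewrite in_cons mem_cat mem_enum vsY YP.
  have [->|_] /= := eqVneq x u; first by rewrite uX.
  by have [xL|_] /= := boolP (x \in L); [move: xL; rewrite inE => /andP[->]|rewrite andbT].
- move=> e; rewrite inE mem_cat => /or3P[/eqP->|/mapP[l]|/eadj//] /=.
    by rewrite adjC pa.
  by rewrite mem_enum inE => /and3P[lX lx0 /eqP lu] -> /=; rewrite -lu adjC pa.
Qed.

(** * Acyclic connected graphs as rooted trees *)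

Definition within (T : finType) (adj : rel T) (X : {set T}) : rel T :=
  [rel x y | [&& x \in X, y \in X & adj x y]].

(* Two edges from c into a connected set would close a cycle through c. *)
Lemma acyclic_one_edge (G : sgraph) (X : {set G}) (c p q : G) :
  acyclic G -> {in X &, forall x y, connect (within (@adj G) X) x y} ->
  c \notin X -> p \in X -> q \in X -> adj c p -> adj c q -> p = q.
Proof.
move=> acG conX cX pX qX cp cq; apply/eqP/negPn/negP => pq.
have /connectP[s0 s0P qE] := conX p q pX qX.
case/shortenP: s0P qE => s sP us _ qE.
have sX : {subset p :: s <= X}.
  elim: s {us qE} p pX sP {cp pq} => [|y s IH] p pX /=.
    by move=> _ x; rewrite inE => /eqP->.
  case/andP=> /and3P[_ yX _] /(IH _ yX) H x; rewrite inE => /predU1P[->//|].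
  exact: H.
have : ucycle (@adj G) [:: c, p & s].
  rewrite /ucycle /= cp rcons_path -qE adj_sym cq andbT; apply/andP; split.
    by apply: sub_path sP => x y /and3P[].
  by move: us; rewrite /= => ->; rewrite andbT; apply: contra cX => /sX.
(* The cycle has length below 3, so [s] is empty and [p = q]. *)
move/acG; case: s qE {sP us sX} => //= qE _.
by rewrite qE eqxx in pq.
Qed.

(** A rooted set grows from [x0] one vertex at a time: the new vertex [c] has a unique neighbour [p]
    in the connected set [X], which becomes its parent. The last clause serves to bound the number
    of edges from above. *)
Lemma tree_rooted (G : sgraph) : is_tree G ->
  exists x0 par d, rooted_on (@adj G) [set: G] x0 par d /\
    forall x y, adj x y -> (x != x0) && (y == par x) || (y != x0) && (x == par y).
Proof.
case=> /card_gt0P[x0 _] conG acG.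
have H m : m < #|G| -> exists (X : {set G}) par d, [/\ #|X| = m.+1,
    rooted_on (@adj G) X x0 par d,
    {in X &, forall x y, adj x y ->
       (x != x0) && (y == par x) || (y != x0) && (x == par y)}
    & {in X &, forall x y, connect (within (@adj G) X) x y}].
  elim: m => [|m IH] ltm.
    exists [set x0], id, (fun=> 0); split; first by rewrite cards1.
    - by split; rewrite ?set11 // => x; rewrite inE => /eqP->; rewrite eqxx.
    - by move=> x y /set1P-> /set1P->; rewrite adj_irrefl.
    - by move=> x y /set1P-> /set1P->; apply: connect0.
  have [X [par [d [cX [x0X d0 pX pa pd] adjX conX]]]] := IH (ltnW ltm).
  have [p [c [pX' cX' pc]]] : exists p c, [/\ p \in X, c \notin X & adj p c].
    (* A set that no edge leaves is all of [G] by connectivity, but [X] has only [m.+1 < #|G|]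
       vertices. *)
    have clos : ~ closed (@adj G) (mem X).
      move=> clX; have : X = setT.
        by apply/setP=> y; rewrite inE -(closed_connect clX (conG x0 y)).
      by move=> XT; move: ltm; rewrite -cX XT cardsT ltnn.
    have [/existsP[p /andP[pX' /existsP[c /andP[cX' pc]]]]|no] :=
      boolP [exists p, (p \in X) && [exists c, (c \notin X) && adj p c]].
      by exists p, c.
    case: clos; apply: intro_closed => [|x y xy xX].
      by apply: sym_connect_sym; apply: adj_sym.
    apply: contraNT no => yX; apply/existsP; exists x; rewrite [x \in X]xX /=.
    by apply/existsP; exists y; rewrite yX.
  have cNx0 : c != x0 by apply: contraNneq cX' => ->.
  have neq x : x \in X -> (x == c) = false.
    by move=> xX; apply/eqP => xc; rewrite -xc xX in cX'.
  exists (c |: X), (fun x => if x == c then p else par x),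
    (fun x => if x == c then (d p).+1 else d x); split.
  - by rewrite cardsU1 cX' cX.
  - split; rewrite ?in_setU1 ?x0X ?orbT ?neq //.
    + move=> x; rewrite !in_setU1; case: eqVneq => [_ _ _|_ /= xX xx0].
        by rewrite pX' orbT.
      by rewrite pX ?orbT.
    + move=> x; rewrite !in_setU1; case: eqVneq => [-> _ _|_ /= xX xx0].
        by rewrite adj_sym.
      exact: pa.
    + move=> x; rewrite !in_setU1; case: eqVneq => [_ _ _|_ /= xX xx0].
        by rewrite neq.
      by rewrite neq ?pX // pd.
  - have one y : y \in X -> adj c y -> y = p.
      by move=> yX cy; apply: (acyclic_one_edge acG conX cX') => //; rewrite adj_sym.
    move=> x y; rewrite !in_setU1.
    case: (eqVneq x c) => [->|_] /=; case: (eqVneq y c) => [->|_] //=.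
    + by rewrite adj_irrefl.
    + by move=> _ yX /(one y yX)->; rewrite eqxx cNx0.
    + by move=> xX _; rewrite adj_sym => /(one x xX)->; rewrite eqxx cNx0 orbT.
    + by move=> xX yX; apply: adjX.
  - have mono x y : connect (within (@adj G) X) x y ->
        connect (within (@adj G) (c |: X)) x y.
      apply: connect_sub => {}x {}y /and3P[xX yX xy]; apply: connect1.
      by rewrite /within /= !in_setU1 xX yX !orbT.
    have cS : connect_sym (within (@adj G) (c |: X)).
      by apply: sym_connect_sym => x y; rewrite /within /= adj_sym andbCA.
    have toc x : x \in X -> connect (within (@adj G) (c |: X)) x c.
      move=> xX; apply: connect_trans (mono _ _ (conX _ _ xX pX')) _.
      by apply: connect1; rewrite /within /= !in_setU1 eqxx pX' pc orbT.
    move=> x y; rewrite !in_setU1.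
    case: (eqVneq x c) => [->|_] /=; case: (eqVneq y c) => [->|_] //=.
    + by move=> _ yX; rewrite cS toc.
    + by move=> xX _; apply: toc.
    + by move=> xX yX; apply/mono/conX.
have G_gt0 : 0 < #|G| by apply/card_gt0P; exists x0.
have [|X [par [d [cX rX adjX _]]]] := H #|G|.-1; first by rewrite prednK.
have XT : X = [set: G].
  by apply/eqP; rewrite eqEcard subsetT cX prednK // cardsT leqnn.
by exists x0, par, d; split=> [|x y]; rewrite -?XT //; apply: adjX; rewrite XT.
Qed.

(** The list [es] supplies [#|G| - 1] distinct edges of [G]; conversely each edge is [{x, par x}]
    with [x != x0], so there are no others. *)
Lemma tree_star_built (G : sgraph) : is_tree G ->
  exists vs es, [/\ star_built vs es, vs =i G, size es = nedges G
    & edges G = [set:: [seq [set e.1; e.2] | e <- es]]].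
Proof.
move=> /tree_rooted[x0 [par [d [rG adjG]]]].
have [vs [es [tr vsG eadj]]] := rooted_star_built (@adj_sym G) rG.
have vsG' : vs =i G by move=> x; rewrite vsG !inE.
have szes : (size es).+1 = #|G|.
  by rewrite -(star_built_size tr) -(card_uniqP (star_built_uniq tr)); apply: eq_card.
have cE : #|[set:: [seq [set e.1; e.2] | e <- es]]| = size es.
  rewrite cardsE (card_uniqP (star_built_uniq_edges tr)) size_map //.
have sub : [set:: [seq [set e.1; e.2] | e <- es]] \subset edges G.
  apply/subsetP=> s; rewrite inE => /mapP[e ees ->].
  by apply/imsetP; exists e; rewrite ?inE ?eadj.
have le : nedges G <= size es.
  have : edges G \subset [set [set x; par x] | x in [set~ x0]].
    apply/subsetP=> s /imsetP[[x y]]; rewrite inE /= => xy ->.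
    case/orP: (adjG _ _ xy) => /andP[nx0 /eqP->]; apply/imsetP.
      by exists x; rewrite // !inE.
    by exists y; rewrite ?inE // setUC.
  move/subset_leq_card/leq_trans; apply; apply: leq_trans (leq_imset_card _ _) _.
  by rewrite cardsC1 -szes.
have E : edges G = [set:: [seq [set e.1; e.2] | e <- es]].
  by apply/esym/eqP; rewrite eqEcard sub cE.
by exists vs, es; split=> //; rewrite /nedges E cE.
Qed.

(** * Degrees and edge counts in a two-coloured complete graph *)

Section Colored.

Variables (V : finType) (red : rel V).
Hypothesis redC : symmetric red.
Implicit Types (i : bool) (S X Y Z : {set V}) (x y z : V).

(** The index [i] is [true] for red and [false] for blue, so both colours share one argument. The
    diagonal, where [red] may take any value, is excluded. *)
Definition col i x y := (x != y) && (red x y == i).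
Arguments col i x y /.

Definition nbrs i S x := [set y in S | col i x y].

(* When X = Y every edge is counted twice. *)
Definition cross i X Y := \sum_(x in X) #|nbrs i Y x|.

Lemma col_sym i : symmetric (col i).
Proof. by move=> x y; rewrite /= redC eq_sym. Qed.

Lemma in_nbrs i S x y : (y \in nbrs i S x) = (y \in S) && col i x y.
Proof. by rewrite inE. Qed.

Lemma crossC i X Y : cross i X Y = cross i Y X.
Proof.
rewrite /cross; under eq_bigr do rewrite -sum1dep_card.
rewrite (exchange_big_dep (mem Y)) /=; last by move=> x y _ /andP[].
apply: eq_bigr => y yY; rewrite -sum1dep_card.
by apply: eq_bigl => x; rewrite yY [in LHS]redC [in LHS]eq_sym.
Qed.

Lemma crossUr i X Y Z :
  [disjoint Y & Z] -> cross i X (Y :|: Z) = cross i X Y + cross i X Z.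
Proof.
move=> dYZ; rewrite /cross -big_split; apply: eq_bigr => x _ /=.
have -> : nbrs i (Y :|: Z) x = nbrs i Y x :|: nbrs i Z x.
  by apply/setP=> y; rewrite !inE andb_orl.
rewrite cardsU; have -> : nbrs i Y x :&: nbrs i Z x = set0; last by rewrite cards0 subn0.
apply/setP=> y; rewrite !inE; case yY: (y \in Y) => //=.
by rewrite (disjointFr dYZ yY) andbF.
Qed.

Lemma crossUl i X Y Z :
  [disjoint Y & Z] -> cross i (Y :|: Z) X = cross i Y X + cross i Z X.
Proof. by move=> dYZ; rewrite crossC crossUr // ![cross i X _]crossC. Qed.

Lemma nbrs_true_false S x : #|nbrs true S x| + #|nbrs false S x| = #|S :\ x|.
Proof.
rewrite -(cardsID (nbrs true S x) (S :\ x)); congr (_ + _); apply: eq_card => y.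
  rewrite !inE /= eq_sym; case: (y \in S); rewrite ?andbF //=.
  by case: eqVneq.
rewrite !inE /= eq_sym; case: (y \in S); rewrite ?andbF //=.
by case: eqVneq => //= _; case: (red x y).
Qed.

Lemma cross_D1 i S z : z \in S ->
  cross i S S = cross i (S :\ z) (S :\ z) + 2 * #|nbrs i S z|.
Proof.
move=> zS; have dz : [disjoint [set z] & S :\ z].
  by rewrite disjoints1 !inE eqxx.
have z0 : cross i [set z] [set z] = 0.
  rewrite /cross big_set1; apply: eq_card0 => y; rewrite !inE /= eq_sym.
  by case: eqVneq.
have zE : cross i [set z] (S :\ z) = #|nbrs i S z|.
  rewrite /cross big_set1; apply: eq_card => y; rewrite !inE /= eq_sym.
  by case: eqVneq; rewrite ?andbF.
rewrite -{1 2}(setD1K zS) crossUl // !crossUr // z0 [cross i (S :\ z) _]crossC zE.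
lia.
Qed.

Lemma cross_self_le i S : cross i S S <= #|S| * #|S|.-1.
Proof.
rewrite /cross -sum_nat_const; apply: leq_sum => x xS.
apply: leq_trans (subset_leq_card (_ : _ \subset S :\ x)) _; last first.
  by rewrite (cardsD1 x S) xS.
by apply/subsetP=> y; rewrite !inE /= eq_sym => /and3P[-> -> _].
Qed.

Lemma cross_true_false X Y : [disjoint X & Y] ->
  cross true X Y + cross false X Y = #|X| * #|Y|.
Proof.
move=> dXY; rewrite -big_split -sum_nat_const /=; apply: eq_bigr => x xX.
rewrite nbrs_true_false; apply: eq_card => y; rewrite !inE.
by case: eqVneq => [->|//]; rewrite (disjointFr dXY xX).
Qed.

(* If not, S splits into A, of red degrees < k, and C, of blue degrees < k;
   the edge counts force both parts to have at least 2k vertices, and then the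
   |A||C| edges between them are too many. *)
Lemma bichromatic_vertex S k : 0 < k ->
  (forall i, 2 * k.-1 * #|S| < cross i S S) ->
  exists2 z, z \in S & forall i, k <= #|nbrs i S z|.
Proof.
case: k => // k _ /= big.
have [/existsP[z /andP[zS /andP[zt zf]]]|no] :=
  boolP [exists z, (z \in S) && ((k < #|nbrs true S z|) && (k < #|nbrs false S z|))].
  by exists z => // -[].
pose A := [set x in S | #|nbrs true S x| <= k]; pose C := S :\: A.
have sAS : A \subset S by apply/subsetP=> x; rewrite inE => /andP[].
have dAC : [disjoint A & C] by rewrite -setI_eq0 setIDA setIC -setIDA setDv setI0.
have SE : S = A :|: C by rewrite -{1}(setID S A) (setIidPr sAS).
have bound i X : {in X, forall x, #|nbrs i S x| <= k} -> cross i X S <= k * #|X|.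
  by move=> H; rewrite mulnC -sum_nat_const; apply: leq_sum.
have At : cross true A S <= k * #|A|.
  by apply: bound => x; rewrite inE => /andP[].
have Cf : cross false C S <= k * #|C|.
  apply: bound => x.
  rewrite !inE => /andP[nA xS]; rewrite xS /= -ltnNge in nA.
  by have := existsPn no x; rewrite xS nA /= -leqNgt.
have cS : #|S| = #|A| + #|C|.
  by rewrite SE cardsU disjoint_setI0 // cards0 subn0.
have := big true; have := big false; rewrite cS {1 2 3 4}SE.
rewrite !crossUl // !crossUr // ![cross _ C A]crossC.
have := cross_self_le true C; have := cross_self_le false A.
have := cross_true_false dAC.
move: At Cf; rewrite {1 2}SE !crossUr // [cross false C A]crossC.
move: (cross true A A) (cross false A A) (cross true A C) (cross false A C)
  (cross true C C) (cross false C C) => x1 x2 y1 y2 z1 z2.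
move: #|A| #|C| => a c H1 H2 H3 H4 H5 H6 H7.
(* Here [k] is one less than in the statement. Red pairs meeting [A] contribute
   [x1 + 2 * y1 <= 2 * k * a] to the red total, so [2 * k * c < z1 <= c * c.-1]. The bound on [a] is
   the same with colours exchanged. *)
have ck : 2 * k < c.-1 by nia.
have ak : 2 * k < a.-1 by nia.
(* Now [a * c > k * (a + c)], against [a * c = y1 + y2] with [y1 <= k * a] and [y2 <= k * c]. *)
nia.
Qed.

(** Deleting a vertex with fewer than [k] neighbours of colour [i] lowers [cross] by at most
    [2 * k.-1], so the density hypothesis survives. It fails for the empty set, so the deletions
    stop before that. *)
Lemma dense_subset i S k : 0 < k -> 2 * k.-1 * #|S| < cross i S S ->
  exists S', [/\ S' \subset S, 0 < #|S'| & {in S', forall x, k <= #|nbrs i S' x|}].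
Proof.
move=> k_gt0; have [m] := ubnP #|S|; elim: m S => // m IH S.
rewrite ltnS => leSm big.
have [/existsP[z /andP[zS zk]]|no] := boolP [exists z, (z \in S) && (#|nbrs i S z| < k)].
  have [||S' [sS' S'0 degS']] := IH (S :\ z).
  - by move: leSm; rewrite (cardsD1 z S) zS.
  - by move: big; rewrite (cross_D1 i zS) (cardsD1 z S) zS; move: zk; nia.
  by exists S'; split=> //; apply: subset_trans sS' (subsetDl _ _).
exists S; split=> // [|x xS]; last first.
  by have := existsPn no x; rewrite xS /= -leqNgt.
rewrite card_gt0; apply: contraTneq big => ->.
by rewrite cards0 muln0 /cross big_set0.
Qed.

(** * Embeddings of trees with prescribed colours *)

Section Embed.

Variable T : eqType.
Implicit Types (vs : seq T) (es : seq (T * T)) (f : T -> V).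

Definition embeds vs S f := {in vs &, injective f} /\ {in vs, forall t, f t \in S}.

Definition im_edges f es := [seq (f e.1, f e.2) | e <- es].

(** The map is extended by sending [u] to [z] and [ls] to [zs] in order. Colours are later counted
    on the explicit edge list in the conclusion. *)
Lemma embeds_star vs es w u ls S f z zs :
  star_built vs es -> uniq (u :: ls ++ vs) -> w \in vs ->
  embeds vs S f -> z \in S -> z \notin map f vs -> size zs = size ls ->
  uniq zs -> {in zs, forall y, [&& y \in S, y != z & y \notin map f vs]} ->
  exists2 f', embeds (u :: ls ++ vs) S f' &
    im_edges f' ((w, u) :: [seq (u, l) | l <- ls] ++ es) =
      (f w, z) :: [seq (z, y) | y <- zs] ++ im_edges f es.
Proof.
move=> tr uniq_all wvs [f_inj fS] zS zf szs uzs zsP.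
pose f' t := if t == u then z else if t \in ls then nth z zs (index t ls) else f t.
case/andP: uniq_all; rewrite mem_cat negb_or -/(uniq _) cat_uniq.
move=> /andP[uls uvs] /and3P[uniq_ls /hasPn dis _].
have fu : f' u = z by rewrite /f' eqxx.
have fls l : l \in ls -> f' l = nth z zs (index l ls).
  by rewrite /f'; case: eqVneq => [->|_ ->] //; rewrite (negbTE uls).
have fvs t : t \in vs -> f' t = f t.
  rewrite /f' => tvs; case: eqVneq => [tu|_]; first by rewrite -tu tvs in uvs.
  by have /negbTE-> : t \notin ls by exact: dis.
have map_ls : map f' ls = zs.
  rewrite (@eq_in_map _ _ _ (fun l => nth z zs (index l ls)) ls).1 //.
  apply: (@eq_from_nth _ z) => [|j]; rewrite size_map ?szs // => jl.
  by rewrite (nth_map u) // index_uniq.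
have map_vs : map f' vs = map f vs by apply/eq_in_map.
have map_all : map f' (u :: ls ++ vs) = z :: zs ++ map f vs.
  by rewrite /= map_cat fu map_ls map_vs.
(* Injectivity of [f'] will be read off from the absence of repetitions among its values. *)
have uniq_map : uniq (map f' (u :: ls ++ vs)).
  rewrite map_all /= mem_cat negb_or zf andbT cat_uniq uzs map_inj_in_uniq //.
  rewrite (star_built_uniq tr) andbT /=; apply/andP; split.
    by apply/negP => /zsP; rewrite eqxx andbF.
  by apply/hasPn=> y yf; apply/negP => /zsP; rewrite yf !andbF.
exists f'.
  split=> [t1 t2 t1in t2in E|t tin].
    rewrite -[t1](nth_index u t1in) -[t2](nth_index u t2in); congr nth.
    apply/eqP; rewrite -(nth_uniq z _ _ uniq_map) ?size_map ?index_mem //.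
    by rewrite !(nth_map u) ?index_mem // !nth_index // E.
  have : f' t \in map f' (u :: ls ++ vs) by apply: map_f.
  rewrite map_all inE mem_cat => /or3P[/eqP->//|/zsP /and3P[]//|/mapP[t' t'vs ->]].
  exact: fS.
rewrite /im_edges /= map_cat fu fvs //; congr (_ :: _ ++ _).
  by rewrite -map_ls -!map_comp; apply: eq_map => l /=; rewrite fu.
apply/eq_in_map => e ees; have /andP[e1 e2] := star_built_mem tr ees.
by rewrite /= !fvs.
Qed.

Lemma embeds_sub vs S S' f : S \subset S' -> embeds vs S f -> embeds vs S' f.
Proof.
by move=> /subsetP sSS' [f_inj fS]; split=> // t tvs; apply/sSS'/fS.
Qed.

Lemma fresh_seq (X : {set V}) (F : seq V) n : n + size F <= #|X| ->
  exists zs, [/\ size zs = n, uniq zs & {in zs, forall y, (y \in X) && (y \notin F)}].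
Proof.
move=> le; pose X' := X :\: [set:: F].
have leX' : n <= #|X'|.
  rewrite cardsD; suff : #|X :&: [set:: F]| <= size F by lia.
  apply: leq_trans (card_size F); apply: subset_leq_card.
  by apply/subsetP=> y; rewrite !inE => /andP[].
exists (take n (enum X')); split.
- by rewrite size_takel // -cardE.
- by rewrite take_uniq // enum_uniq.
- by move=> y /mem_take; rewrite mem_enum !inE andbC.
Qed.

(** Stars are placed one after another: a placed vertex has at least [k] neighbours of colour [i],
    enough to avoid the images already used. *)
Lemma greedy_embedding vs es i S k : star_built vs es -> size es <= k ->
  0 < #|S| -> {in S, forall x, k <= #|nbrs i S x|} ->
  exists2 f, embeds vs S f & all (fun e => col i e.1 e.2) (im_edges f es).
Proof.
move=> + + /card_gt0P[x0 x0S] degS.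
elim=> [t _|{}vs {}es w u ls tr IH wvs uniq_all _ lek].
  exists (fun=> x0) => //; split=> // t1 t2.
  by rewrite !inE => /eqP-> /eqP->.
rewrite /= size_cat size_map in lek.
have [|f [f_inj fS] colf] := IH; first by lia.
have sz_f : size (map f vs) = (size es).+1 by rewrite size_map (star_built_size tr).
have uniq_f : uniq (map f vs) by rewrite map_inj_in_uniq ?(star_built_uniq tr).
have fw : f w \in map f vs by exact: map_f.
have degw := degS _ (fS w wvs).
(* As [f w] is not its own neighbour, only the other [size es] images have to be avoided. *)
have [|[|z zs0] [// _ _ zP]] := @fresh_seq (nbrs i S (f w)) (rem (f w) (map f vs)) 1.
  by rewrite size_rem // sz_f /=; lia.
have /andP[] := zP z (mem_head _ _).
rewrite in_nbrs mem_rem_uniq // inE negb_and negbK => /andP[zS /andP[fwz redz]].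
rewrite [z == _]eq_sym (negbTE fwz) orFb => zf.
have [|zs [szs uzs zsP]] := @fresh_seq (nbrs i S z) (map f vs) (size ls).
  by have := degS z zS; rewrite sz_f; lia.
have [|f' f'S E] := embeds_star tr uniq_all wvs (conj f_inj fS) zS zf szs uzs.
  move=> y /zsP /andP[]; rewrite in_nbrs /= => /and3P[yS zy _] yf.
  by rewrite yS yf eq_sym zy.
exists f' => //; rewrite E /= fwz redz /= all_cat all_map; apply/andP; split=> //.
by apply/allP=> y /zsP /andP[]; rewrite in_nbrs => /andP[].
Qed.

Lemma dense_embedding vs es S r : star_built vs es -> r <= size es ->
  (forall i, 2 * (size es).-1 * #|S| < cross i S S) ->
  exists2 f, embeds vs S f & count (fun e => red e.1 e.2) (im_edges f es) = r.
Proof.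
move=> tr; elim: tr S r => [t|{}vs {}es w u ls tr IH wvs uniq_all ls_es] S r.
  move=> r0 big; have [x0 x0S] : exists x0, x0 \in S.
    apply/set0Pn; apply: contraTneq (big true) => ->.
    by rewrite /cross big_set0.
  exists (fun=> x0); first by split=> // t1 t2; rewrite !inE => /eqP-> /eqP->.
  by move: r0; rewrite leqn0 => /eqP->.
set es' := (w, u) :: _; have tr' : star_built (u :: ls ++ vs) es'.
  exact: star_built_star.
have sz' : size es' = (size ls + size es).+1 by rewrite /= size_cat size_map.
move=> ler big.
have mono i : exists2 f, embeds (u :: ls ++ vs) S f &
    all (fun e => col i e.1 e.2) (im_edges f es').
  have [|S' [sS'S S'0 degS']] := dense_subset _ (big i); first by rewrite sz'.
  have [f fS' colf] := greedy_embedding tr' (leqnn _) S'0 degS'.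
  by exists f => //; apply: embeds_sub fS'.
have [r0|r_gt0] := posnP r.
  have [f fS colf] := mono false; exists f => //; rewrite r0; apply/eqP.
  rewrite -leqn0 leqNgt -has_count -all_predC; apply: sub_all colf => e /=.
  by case/andP=> _ /eqP->.
have [rE|r_neq] := eqVneq r (size es').
  have [f fS colf] := mono true; exists f => //; rewrite rE -(size_map (fun e => (f e.1, f e.2))).
  by apply/eqP; rewrite -all_count; apply: sub_all colf => e /= /andP[_ /eqP->].
have {ler r_neq} ltr : r < size es' by rewrite ltn_neqAle r_neq.
(* With [ls] empty the tree is a single edge, which leaves no [r] with [0 < r < 1]. *)
have ls_gt0 : 0 < size ls.
  by case/orP: ls_es => [|/eqP es0]; [case: (ls)|move: ltr; rewrite sz' es0 /=; lia].
have [|z zS degz] := bichromatic_vertex _ big; first by rewrite sz'.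
have Dz : #|S| = #|S :\ z|.+1 by rewrite (cardsD1 z S) zS.
(* The smaller tree gets as many red edges as possible while at least one is kept for the new star,
   so a red edge from [f w] to [z] cannot overshoot [r]. *)
have [||f [f_inj fS] cf] := IH (S :\ z) (minn r.-1 (size es)).
- exact: geq_minr.
(* Deleting [z] costs at most [2 * #|S :\ z|], less than the [2 * #|S|] gained because the factor
   drops from [size ls + size es] to [(size es).-1]. *)
- move=> i; have := big i; rewrite (cross_D1 i zS) Dz sz' /=.
  have : #|nbrs i S z| <= #|S :\ z|.
    by have := nbrs_true_false S z; case: i; lia.
  nia.
have zf : z \notin map f vs.
  by apply/mapP=> -[t /fS + zE]; rewrite -zE !inE eqxx.
have sz_f : size (map f vs) = (size es).+1 by rewrite size_map (star_built_size tr).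
pose c := nat_of_bool (red (f w) z); have c1 : c <= 1 by rewrite /c; case: red.
(* The number of leaf edges at [z] that must be red; it fits into [ls] because [ls] is nonempty and
   [r < size es']. *)
pose rl := r - minn r.-1 (size es) - c.
have rl_le : rl <= size ls by rewrite /rl; lia.
(* Of at least [size es'] neighbours in each colour, at most [(size es).+1] are used, so [size ls]
   remain. *)
have pick i n : n <= size ls -> exists zs, [/\ size zs = n, uniq zs
    & {in zs, forall y, (y \in nbrs i S z) && (y \notin map f vs)}].
  by move=> len; apply: fresh_seq; have := degz i; rewrite sz' sz_f; lia.
have [zs1 [sz1 u1 zs1P]] := pick true rl rl_le.
have [zs2 [sz2 u2 zs2P]] := pick false (size ls - rl) (leq_subr _ _).
have red1 y : y \in zs1 -> red z y.
  by case/zs1P/andP; rewrite in_nbrs => /and3P[_ _ /eqP].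
have red2 y : y \in zs2 -> red z y = false.
  by case/zs2P/andP; rewrite in_nbrs => /and3P[_ _ /eqP].
have szs : size (zs1 ++ zs2) = size ls by rewrite size_cat sz1 sz2 subnKC.
have uzs : uniq (zs1 ++ zs2).
  rewrite cat_uniq u1 u2 andbT; apply/hasPn=> y /red2 y2.
  by apply/negP=> /red1; rewrite y2.
have fS' : embeds vs S f by apply: embeds_sub (subsetDl _ _) (conj f_inj fS).
have [|f' f'S E] := embeds_star tr uniq_all wvs fS' zS zf szs uzs.
  move=> y; rewrite mem_cat => /orP[/zs1P|/zs2P] /andP[];
  by rewrite in_nbrs => /and3P[-> /= + _] ->; rewrite eq_sym andbT.
exists f' => //; rewrite E /= map_cat !count_cat cf.
have -> : count (fun e => red e.1 e.2) [seq (z, y) | y <- zs1] = rl.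
  by rewrite count_map -sz1; apply/eqP; rewrite -all_count; apply/allP.
have -> : count (fun e => red e.1 e.2) [seq (z, y) | y <- zs2] = 0.
  apply/eqP; rewrite count_map -leqn0 leqNgt -has_count.
  by apply/hasPn=> y /red2 /= ->.
by rewrite -/c /rl; lia.
Qed.

End Embed.
End Colored.

(** * From edge sets to colour degrees, and the final bound *)

(** Incidences are counted twice: each member of [F] has two, and those at [x] are determined by
    their other endpoint. *)
Lemma handshake (V : finType) (F : {set {set V}}) :
  {in F, forall e : {set V}, #|e| = 2} ->
  2 * #|F| <= \sum_x #|[set y | (x != y) && ([set x; y] \in F)]|.
Proof.
move=> F2; have -> : 2 * #|F| = \sum_x #|[set e in F | x \in e]|.
  rewrite mulnC -sum_nat_const.
  under [RHS]eq_bigr do rewrite -sum1dep_card.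
  rewrite (exchange_big_dep (mem F)) /=; last by move=> x e _ /andP[].
  apply: eq_bigr => e eF; rewrite -(F2 e eF) -sum1_card.
  by apply: eq_bigl => x; rewrite eF.
apply: leq_sum => x _.
apply: leq_trans (leq_imset_card (fun y => [set x; y]) _).
apply: subset_leq_card; apply/subsetP=> e; rewrite inE => /andP[eF xe].
have /eqP/cards2P[a [b [ab eE]]] := F2 e eF.
apply/imsetP; move: xe; rewrite eE !inE => /orP[]/eqP xE; subst x.
  by exists b; rewrite // inE ab -eE.
by exists a; rewrite ?inE 1?eq_sym ?ab 1?setUC -?eE.
Qed.

(** By [handshake], the edge counts of [R] and [B] give the hypothesis of [dense_embedding] on the
    whole vertex set. *)
Lemma dense_coloring_copy (n : nat) (T : sgraph) (R B : {set {set K n}}) r b :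
  is_tree T -> two_coloring R B -> (nedges T).-1 * n < minn #|R| #|B| ->
  r + b = nedges T -> colored_copy T R B r b.
Proof.
move=> /tree_star_built[vs [es [tr vsT szes edgesT]]] /andP[/eqP RB disRB].
rewrite leq_min => /andP[bigR bigB] rb.
pose red : rel 'I_n := fun x y => [set x; y] \in R.
have redC : symmetric red by move=> x y; rewrite /red setUC.
have edge2 e : (e \in R) || (e \in B) -> #|e| = 2.
  by rewrite -in_setU RB edges_KE inE => /eqP.
have BE (x y : 'I_n) : x != y -> ([set x; y] \in B) = ~~ red x y.
  move=> xy; have : [set x; y] \in R :|: B by rewrite RB edges_KE inE cards2 xy.
  rewrite inE /red; case: (boolP ([set x; y] \in R)) => //= xyR _.
  by rewrite (disjointFr disRB xyR).
have dense i : 2 * (size es).-1 * #|[set: 'I_n]| < cross red i setT setT.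
  rewrite cardsT card_ord szes -mulnA.
  have hs (F : {set {set 'I_n}}) : {in F, forall e : {set 'I_n}, #|e| = 2} ->
      (forall x y : 'I_n, x != y -> ([set x; y] \in F) = (red x y == i)) ->
      2 * #|F| <= cross red i setT setT.
    move=> F2 FE; apply: leq_trans (handshake F2) _; rewrite /cross.
    rewrite [leqRHS](eq_bigl predT) => [|x]; last by rewrite inE.
    apply: leq_sum => x _; apply: subset_leq_card; apply/subsetP=> y.
    by rewrite !inE /col => /andP[xy]; rewrite FE // xy.
  case: i hs => hs.
    apply: leq_trans (hs R _ _); first by rewrite ltn_pmul2l.
      by move=> e eR; apply: edge2; rewrite eR.
    by move=> x y _; rewrite eqb_id.
  apply: leq_trans (hs B _ _); first by rewrite ltn_pmul2l.
    by move=> e eB; apply: edge2; rewrite eB orbT.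
  by move=> x y xy; rewrite BE // eqbF_neg.
have ler : r <= size es by rewrite szes -rb leq_addr.
have [f [f_inj _] cf] := dense_embedding redC tr ler dense.
have inj_f : injective f by move=> x y; apply: f_inj; rewrite vsT.
have setsE : [seq [set e.1; e.2] | e <- im_edges f es]
    = [seq f @: e | e : {set T} <- [seq [set e.1; e.2] | e <- es]].
  by rewrite -!map_comp; apply: eq_map => e /=; rewrite imsetU !imset_set1.
(* Injectivity of [f] keeps the image edges distinct, so counting along [es] gives cardinalities. *)
have count_copy (P : pred {set 'I_n}) :
    #|[set f @: e | e : {set T} in edges T] :&: [set s | P s]|
    = count (fun e => P [set e.1; e.2]) (im_edges f es).
  have -> : [set f @: e | e : {set T} in edges T] :&: [set s | P s]
          = [set:: [seq s <- [seq [set e.1; e.2] | e <- im_edges f es] | P s]].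
    apply/setP=> s; rewrite !inE mem_filter andbC; congr (_ && _).
    rewrite setsE.
    apply/imsetP/mapP => -[e eT ->]; exists e => //; move: eT;
    by rewrite edgesT inE.
  rewrite cardsE (card_uniqP _) ?size_filter ?count_map //.
  rewrite filter_uniq //.
  rewrite setsE.
  by rewrite (map_inj_uniq (imset_inj inj_f)) (star_built_uniq_edges tr).
apply/existsP; exists (f @: [set: T]).
apply/existsP; exists [set f @: e | e : {set T} in edges T].
apply/and3P; split.
- apply/andP; split.
    apply/subsetP=> _ /imsetP[_ /imsetP[[x y] /= xy ->] ->].
    rewrite edges_KE inE imsetU !imset_set1 cards2 (inj_eq inj_f).
    by case: (eqVneq x y) xy => [->|//]; rewrite inE /= adj_irrefl.
  apply/existsP; exists [ffun x => f x]; apply/and3P; split.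
  + by apply/injectiveP=> x y; rewrite !ffunE => /inj_f.
  + by apply/eqP/eq_imset=> x; rewrite ffunE.
  + by apply/eqP/eq_imset=> e; apply: eq_imset => x; rewrite ffunE.
- have := count_copy (mem R); rewrite (_ : [set s | _] = R); last first.
    by apply/setP=> s; rewrite inE.
  by move=> ->; rewrite cf.
- have := count_copy (mem B); rewrite (_ : [set s | _] = B); last first.
    by apply/setP=> s; rewrite inE.
  (* Image edges have distinct ends, where blue is the complement of red; so [size es - r = b] of
     them are blue. *)
  move=> ->; rewrite -(eqn_add2l r) rb -szes -{1}cf.
  rewrite -(size_map (fun e => (f e.1, f e.2)) es).
  rewrite -(count_predC (fun e => red e.1 e.2)) eqn_add2l; apply/eqP.
  apply: eq_in_count => _ /mapP[e ees ->] /=; rewrite -BE //.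
  rewrite (inj_eq inj_f); have : [set e.1; e.2] \in edges T.
    by rewrite edgesT inE; apply: map_f.
  case/imsetP=> -[x y] /= xy eE; apply: contraL xy => /eqP e12.
  have : #|[set x; y]| = 1 by rewrite -eE e12 setUid cards1.
  by rewrite cards2; case: (eqVneq x y) => // ->; rewrite inE /= adj_irrefl.
Qed.

Theorem theorem4p3 (n k : nat) (hn : 0 < n) (hk : 0 < k) (hnk : 4 * k <= n)
    (T : sgraph) (hT : is_tree T) (hTk : nedges T = k) :
  ot n T <= (k - 1) * n.
Proof.
(* As [ot] is a minimum, it suffices that [(k - 1) * n] is itself admissible. *)
rewrite /ot; case: ex_minnP => s _; apply.
apply/forallP=> R; apply/forallP=> B; apply/implyP=> RB; apply/implyP=> big.
apply/omnitonalP=> r b rb; apply: dense_coloring_copy => //.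
by rewrite hTk -subn1.
Qed.
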